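(* Let $\lambda$ be a real number with $\lambda\ge -\frac12$, let $n\ge 3$ be an integer, and let $T\in\mathcal{T}_{n,\Delta}$ (that is, $T$ is a tree with $n$ vertices and maximum degree $\Delta$). Then $$GRM_{\lambda}(T)\ \ge\ \begin{cases} n(\lambda+2)^2-3(\lambda+2)+(\lambda+1)(\Delta^2-3\Delta-\lambda), & \text{if } \Delta<n-1,\\[2mm] (n-1)(n-1+\lambda)(1+\lambda), & \text{if } \Delta=n-1.\end{cases}$$ Equality holds if and only if $T$ is a spider graph with at most one leg of length more than one.
   Context: All graphs are finite and simple. For a graph $\Gamma$ and a real number $\lambda$, the general reduced second Zagreb index is $$GRM_\lambda(\Gamma)=\sum_{ab\in E(\Gamma)}(\deg_{\Gamma}(a)+\lambda)(\deg_{\Gamma}(b)+\lambda).$$ $\mathcal{T}_{n,\Delta}$ denotes the set of all trees with $n$ vertices and maximum degree $\Delta$. A spider is a tree with at most one vertex of degree greater than two; that vertex is called its center. A leg of a spider is a path from the center to a leaf (vertex of degree one); its length is its number of edges. A star is a spider all of whose legs have length one. By convention a path is also considered a spider, having either one leg (the center being an end-vertex) or two legs (the center being an internal vertex); in particular every path is a spider with at most one leg of length more than one (take the center to be an end-vertex). *)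

(* Defs.v *)
From mathcomp Require Import all_boot all_order all_algebra.
From mathcomp Require Import reals.

Set Implicit Arguments.
Unset Strict Implicit.
Unset Printing Implicit Defensive.

Import Order.TTheory GRing.Theory Num.Theory.

Record sgraph (V : finType) := SGraph {
  adj :> rel V;
  adj_sym : symmetric adj;
  adj_irrefl : irreflexive adj }.

Definition deg (V : finType) (G : sgraph V) (x : V) : nat :=
  #|[set y | G x y]|.

Definition max_degree (V : finType) (G : sgraph V) : nat :=
  \max_(x : V) deg G x.

Definition edges (V : finType) (G : sgraph V) : {set {set V}} :=
  [set [set p.1; p.2] | p : V * V & G p.1 p.2].

(* The adjacency is irreflexive, so an edge E = {a, b} has exactly two elements
   and the inner product is (deg a + lam) * (deg b + lam). *)
Definition GRM (R : realType) (lam : R) (V : finType) (G : sgraph V) : R :=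
  (\sum_(E in edges G) \prod_(a in E) ((deg G a)%:R + lam))%R.

Definition connected_graph (V : finType) (G : sgraph V) : Prop :=
  forall x y : V, connect G x y.

(* Any edge {x, y} gives the degenerate closed walk [:: x; y], so genuine
   cycles are those with at least three vertices. *)
Definition acyclic (V : finType) (G : sgraph V) : Prop :=
  forall c : seq V, cycle G c -> uniq c -> size c <= 2.

Definition is_tree (V : finType) (G : sgraph V) : Prop :=
  [/\ 0 < #|V|, connected_graph G & acyclic G].

Definition in_trees (n Delta : nat) (V : finType) (G : sgraph V) : Prop :=
  [/\ is_tree G, #|V| = n & max_degree G = Delta].

Definition is_spider (V : finType) (G : sgraph V) : Prop :=
  is_tree G /\ #|[set x | 2 < deg G x]| <= 1.

(* When no vertex has degree greater than two the spider is a path, and every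
   vertex, end-vertex or internal, is admitted as a center. *)
Definition is_center (V : finType) (G : sgraph V) (c : V) : Prop :=
  forall x : V, 2 < deg G x -> x = c.

Definition is_leaf (V : finType) (G : sgraph V) (x : V) : Prop :=
  deg G x = 1.

(* The leg is the simple path c :: p, so its number of edges is size p.  The
   trivial path is excluded: it would otherwise count as a leg when c is itself
   a leaf. *)
Definition is_leg (V : finType) (G : sgraph V) (c : V) (p : seq V) : Prop :=
  [/\ p <> [::], path G c p, uniq (c :: p) & is_leaf G (last c p)].

(* The center is existentially quantified because it is not unique for a path;
   a path qualifies through either of its end-vertices. *)
Definition spider_le1_long_leg (V : finType) (G : sgraph V) : Prop :=
  is_spider G /\
  exists2 c : V, is_center G c &
    forall p q : seq V, is_leg G c p -> is_leg G c q ->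
      1 < size p -> 1 < size q -> p = q.

(* Main.v *)
(* Root T at a vertex r of maximum degree Delta, and let c v be the number of
   children of v.  Each edge joins a non-root vertex to its parent, so GRM is a
   sum over non-root vertices; regrouping it by parents gives the exact identity
     GRM = (lam+1) Delta (Delta+lam) + (lam+2)^2 (n-1-Delta) + (lam+1) Q + S
   with Q the sum of c v (c v - 1) and S the sum of c v (deg (par v) - 2) over
   v <> r.  If T is not a star, some child of r has a child, so
   S >= Delta - 2.  As lam + 1 > 0, equality forces Q = 0 (every non-root degree
   is at most 2) and S = Delta - 2 (Delta = 2, or r has a single non-leaf
   neighbour), which describes the extremal spiders. *)
Require Import Defs.
From mathcomp Require Import all_boot all_order all_algebra.
From mathcomp Require Import reals.
From mathcomp Require Import zify ring lra.

Set Implicit Arguments.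
Unset Strict Implicit.
Unset Printing Implicit Defensive.

Import Order.TTheory GRing.Theory Num.Theory.
Local Open Scope ring_scope.

(** * Rooting a tree: parents, depths, numbers of children *)

Section Rooting.
Local Open Scope nat_scope.
Variables (V : finType) (G : sgraph V) (r : V).

(** [par r] is arbitrary, hence the guards. The last clause, that every edge joins a vertex to its
    parent, is where acyclicity enters. *)
Definition rooting (par : V -> V) (depth : V -> nat) : Prop :=
  [/\ forall v, v != r -> G v (par v),
      forall v, v != r -> depth v = (depth (par v)).+1
    & forall x y, G x y -> (x != r) && (y == par x) || (y != r) && (x == par y)].

(** Depth is the length of a shortest path to [r]; the second vertex of such a path is one step
    closer. *)
Lemma exists_distance :
  connected_graph G ->
  exists depth : V -> nat,
    forall v, v != r -> exists2 w, G v w & depth v = (depth w).+1.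
Proof.
move=> conn.
pose reach v k := [exists p : k.-tuple V, path G v p && (last v p == r)].
have ex v : exists k, reach v k.
  have /connectP[p Gp lp] := conn v r.
  by exists (size p); apply/existsP; exists (in_tuple p); rewrite Gp -lp eqxx.
exists (fun v => ex_minn (ex v)) => v vr.
case: ex_minnP => k /existsP[[p /= /eqP sp]] /andP[Gp /eqP lp] kmin.
case: p sp Gp lp => [|w p] /= sp; first by move=> _ E; rewrite E eqxx in vr.
case/andP=> Gvw Gp lp; exists w => //.
case: ex_minnP => j jreach jmin.
have rw : reach w (size p).
  by apply/existsP; exists (in_tuple p); rewrite Gp lp eqxx.
have jp := jmin _ rw.
have rv : reach v j.+1.
  case/existsP: jreach => q /andP[Gq lq].
  by apply/existsP; exists (cons_tuple w q); rewrite /= Gvw Gq lq.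
have := kmin _ rv; lia.
Qed.

(** Parents are picked one step closer to [r]. Parent edges already connect all vertices, so any
    further edge would close a cycle. *)
Lemma tree_rooting : is_tree G -> exists par depth, rooting par depth.
Proof.
case=> _ conn acyc.
have [depth dP] := exists_distance conn.
pose par v := odflt v [pick w | G v w && (depth v == (depth w).+1)].
have parP v : v != r -> G v (par v) /\ depth v = (depth (par v)).+1.
  move=> vr; rewrite /par; case: pickP => [w /andP[? /eqP ?] //|/= none].
  by have [w Gvw dv] := dP v vr; move: (none w); rewrite Gvw dv eqxx.
exists par, depth; split=> [v /parP[]|v /parP[]|x y Gxy] //.
pose up a b := (a != r) && (b == par a).
pose e a b := up a b || up b a.
have esym : symmetric e by move=> a b; rewrite /e orbC.
have csym : connect_sym e := sym_connect_sym esym.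
have conr a : connect e a r.
  have [m] := ubnP (depth a); elim: m a => // m IH a am.
  have [->|ar] := eqVneq a r; first exact: connect0.
  have [_ da] := parP a ar.
  apply: connect_trans (IH (par a) _); last by lia.
  by apply: connect1; rewrite /e /up ar eqxx.
have : connect e x y by apply: connect_trans (conr x) _; rewrite csym.
case/connectP=> p0 ep0; case/shortenP: ep0 => p ep up_ _ lp {p0}.
(* Closing p by the edge xy gives a cycle of T, so p has a single edge. *)
have eG : subrel e G.
  move=> a b /orP[] /andP[/parP[? _] /eqP->] //; by rewrite adj_sym.
have := acyc (x :: p); rewrite /= rcons_path (sub_path eG ep) -lp adj_sym Gxy.
move=> /(_ isT up_).
case: p ep lp {up_} => [|z [|]] //=; first by move=> _ E; rewrite E adj_irrefl in Gxy.
by move=> + -> _; rewrite andbT.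
Qed.

Variables (par : V -> V) (depth : V -> nat).
Hypothesis rt : rooting par depth.

Definition nchild (v : V) : nat := #|[set w | (w != r) && (par w == v)]|.

Lemma rooting_par_adj v : v != r -> G v (par v). Proof. by case: rt => + _ _; apply. Qed.

Lemma rooting_depth v : v != r -> depth v = (depth (par v)).+1.
Proof. by case: rt => _ + _; apply. Qed.

Lemma rooting_adj x y :
  G x y = (x != r) && (y == par x) || (y != r) && (x == par y).
Proof.
apply/idP/idP; first by case: rt => _ _; apply.
by case/orP=> /andP[/rooting_par_adj + /eqP->] //; rewrite adj_sym.
Qed.

Lemma deg_root : deg G r = nchild r.
Proof.
by apply: eq_card => w; rewrite !inE rooting_adj eqxx /= [r == _]eq_sym.
Qed.

Lemma deg_nonroot v : v != r -> deg G v = (nchild v).+1.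
Proof.
move=> vr; rewrite /deg /nchild.
have -> : [set y | G v y] = par v |: [set w | (w != r) && (par w == v)].
  by apply/setP=> w; rewrite !inE rooting_adj vr /= [v == _]eq_sym.
(* [par v] is not also a child of [v], since its depth is smaller. *)
rewrite cardsU1 inE; case: andP => // -[pr /eqP E].
by have := rooting_depth vr; have := rooting_depth pr; rewrite E; lia.
Qed.

Lemma nchild_par_gt0 v : v != r -> 0 < nchild (par v).
Proof. by move=> vr; apply/card_gt0P; exists v; rewrite inE vr eqxx. Qed.

Lemma nchild_gt0 v : 0 < nchild v -> exists2 w, w != r & par w = v.
Proof. by case/card_gt0P=> w; rewrite inE => /andP[? /eqP ?]; exists w. Qed.

Lemma deg_par_gt1 v : 1 < deg G r -> v != r -> 1 < deg G (par v).
Proof.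
move=> rr vr; have [-> //|pr] := eqVneq (par v) r.
by rewrite deg_nonroot // ltnS nchild_par_gt0.
Qed.

(** * The index as a sum over non-root vertices *)

Lemma edges_rooting : edges G = [set [set v; par v] | v in [set~ r]].
Proof.
apply/setP=> E; apply/imsetP/imsetP=> [[[x y]]|[v]].
  rewrite inE /= rooting_adj => /orP[] /andP[zr /eqP->] ->.
    by exists x; rewrite // !inE.
  by exists y; rewrite // ?inE // setUC.
rewrite !inE => vr ->; exists (v, par v) => //.
by rewrite inE /= rooting_par_adj.
Qed.

(** Otherwise [v] and [w] would be each other's parent, which depth forbids. *)
Lemma par_edge_inj : {in [set~ r] &, injective (fun v => [set v; par v])}.
Proof.
move=> v w; rewrite !inE => vr wr /setP E.
have := E v; have := E w; rewrite !inE !eqxx /= orbC [w == v]eq_sym => H1 H2.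
have [//|nvw] := eqVneq v w; move: H1 H2; rewrite (negbTE nvw) orbF /=.
move=> /eqP wv /esym /eqP vw.
by have := rooting_depth vr; have := rooting_depth wr; rewrite -wv -vw; lia.
Qed.

Lemma sum_par (M : nmodType) (F : V -> M) :
  (\sum_(v | v != r) F (par v) = \sum_v F v *+ nchild v)%R.
Proof.
rewrite (partition_big par xpredT) //=; apply: eq_bigr => v _.
rewrite (eq_bigr (fun=> F v)); last by move=> w /andP[_ /eqP->].
by rewrite big_const iter_addr_0; congr (_ *+ _)%R; apply: eq_card => w; rewrite !inE.
Qed.

Lemma sum_nchild : \sum_v nchild v = #|V|.-1.
Proof.
have /= := @sum_par nat (fun=> 1); rewrite sum1_card.
rewrite (eq_bigr nchild); last by move=> v _; exact: natn.
by move<-; rewrite (cardC1 r).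
Qed.

Lemma sum_nchild_nonroot : \sum_(v | v != r) nchild v = #|V|.-1 - deg G r.
Proof. by rewrite -sum_nchild [in RHS](bigD1 r) //= -deg_root addKn. Qed.

Lemma deg_root_le : deg G r <= #|V|.-1.
Proof. by rewrite -sum_nchild (bigD1 r) //= -deg_root leq_addr. Qed.

Lemma GRM_rooting (R : realType) (lam : R) :
  (GRM lam G = \sum_(v | v != r) ((deg G v)%:R + lam) * ((deg G (par v))%:R + lam))%R.
Proof.
rewrite /GRM edges_rooting big_imset; last exact: par_edge_inj.
apply: eq_big => [v|v]; rewrite !inE // => vr.
rewrite big_setU1 ?big_set1 // inE; apply/eqP => E.
by have := rooting_par_adj vr; rewrite -E adj_irrefl.
Qed.

(* [.-1] truncates only when the other factor vanishes. *)
Definition branch_excess : nat := \sum_(v | v != r) nchild v * (nchild v).-1.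

(** The truncated subtraction is exact once [r] has degree above 1, as every parent then has degree
    at least 2. *)
Definition par_excess : nat := \sum_(v | v != r) nchild v * (deg G (par v) - 2).

Lemma GRM_excess (R : realType) (lam : R) : 1 < deg G r ->
  (GRM lam G = (lam + 1) * (deg G r)%:R * ((deg G r)%:R + lam)
     + (lam + 2) ^+ 2 * (#|V|.-1 - deg G r)%:R
     + (lam + 1) * branch_excess%:R + par_excess%:R)%R.
Proof.
move=> dr; rewrite GRM_rooting.
pose g v : R := ((deg G v)%:R + lam)%R.
(* Write [deg v + lam] as [(lam + 1) + c v]; in the product with [c v], split [deg (par v) + lam] as
   [(lam + 2) + (deg (par v) - 2)]. *)
have -> : (\sum_(v | v != r) ((deg G v)%:R + lam) * ((deg G (par v))%:R + lam) =
  (lam + 1) * (\sum_(v | v != r) g (par v)) + (lam + 2) * (#|V|.-1 - deg G r)%:R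
  + par_excess%:R)%R.
  rewrite -sum_nchild_nonroot !natr_sum !mulr_sumr -!big_split /=.
  apply: eq_bigr => v vr; rewrite natrM natrB ?deg_par_gt1 // deg_nonroot // /g.
  by rewrite -natr1; ring.
(* Grouped by parents, a non-root vertex with c children contributes c (c + 1 + lam) = (lam + 2) c +
   c (c - 1). *)
have -> : (\sum_(v | v != r) g (par v) = (deg G r)%:R * ((deg G r)%:R + lam)
   + (lam + 2) * (#|V|.-1 - deg G r)%:R + branch_excess%:R)%R.
  rewrite sum_par (bigD1 r) //= -deg_root -[(g r *+ _)%R]mulr_natl -!addrA.
  congr (_ + _)%R.
  rewrite -sum_nchild_nonroot !natr_sum !mulr_sumr -!big_split /=.
  apply: eq_bigr => v vr; rewrite /g deg_nonroot // -mulr_natl natrM.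
  by case: (nchild v) => [|k] /=; rewrite ?mul0r ?mulr0 ?addr0 // -!natr1; ring.
ring.
Qed.

(** * Non-leaf neighbours of the root, and the excess terms *)

Definition inner_nbrs : {set V} := [set v | G r v & 1 < deg G v].

Lemma inner_nbrsP v :
  reflect [/\ v != r, par v = r & 0 < nchild v] (v \in inner_nbrs).
Proof.
rewrite inE rooting_adj eqxx /= [r == _]eq_sym.
apply: (iffP andP) => [[/andP[vr /eqP pv]]|[vr pv cv]].
  by rewrite deg_nonroot.
by rewrite vr pv eqxx deg_nonroot.
Qed.

(** Some non-root vertex has a child; climbing from it reaches a child of [r] that has a child. *)
Lemma inner_nbrs_gt0 : deg G r < #|V|.-1 -> 0 < #|inner_nbrs|.
Proof.
rewrite -subn_gt0 -sum_nchild_nonroot lt0n sum_nat_eq0 negb_forall.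
case/existsP=> v; rewrite negb_imply -lt0n => /andP[vr cv].
have [m] := ubnP (depth v); elim: m v vr cv => // m IH v vr cv dm.
have [pv|pvr] := eqVneq (par v) r.
  by apply/card_gt0P; exists v; apply/inner_nbrsP.
apply: (IH (par v)) => //; first exact: nchild_par_gt0.
by have := rooting_depth vr; lia.
Qed.

Lemma inner_nbrs_eq0 : deg G r = #|V|.-1 -> #|inner_nbrs| = 0.
Proof.
move=> dr; apply: eq_card0 => v; apply/negP => /inner_nbrsP[vr _].
have /eqP := sum_nchild_nonroot; rewrite dr subnn sum_nat_eq0.
by move/forallP/(_ v); rewrite vr => /eqP->.
Qed.

(** Keep only the terms at inner neighbours: each has parent [r] and at least one child. *)
Lemma par_excess_ge : #|inner_nbrs| * (deg G r - 2) <= par_excess.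
Proof.
rewrite -sum_nat_const /par_excess big_mkcond [leqRHS]big_mkcond /=.
apply: leq_sum => v _; case: inner_nbrsP => // -[-> -> cv].
exact: leq_pmull.
Qed.

(** A term whose parent is not [r] vanishes, that parent having degree at most 2; an inner neighbour
    has exactly one child. *)
Lemma par_excess_spider : (forall v, v != r -> deg G v <= 2) ->
  par_excess = #|inner_nbrs| * (deg G r - 2).
Proof.
move=> d2; rewrite -sum_nat_const /par_excess big_mkcond [RHS]big_mkcond /=.
apply: eq_bigr => v _; have [->|vr] := eqVneq v r.
  by case: inner_nbrsP => // -[]; rewrite eqxx.
have := d2 v vr; rewrite deg_nonroot // => cv.
have [pv|pvr] := eqVneq (par v) r.
  case: inner_nbrsP => [[_ _ cv0]|nin].
    have -> : nchild v = 1 by lia.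
    by rewrite pv mul1n.
  by have [->//|cv0] := posnP (nchild v); case: nin.
have /eqP-> : deg G (par v) - 2 == 0 by rewrite subn_eq0 d2.
by rewrite muln0; case: inner_nbrsP => // -[_ E]; rewrite E eqxx in pvr.
Qed.

Lemma branch_excess_eq0 :
  branch_excess = 0 <-> forall v, v != r -> deg G v <= 2.
Proof.
split=> [/eqP|d2].
  rewrite sum_nat_eq0 => /forallP z v vr; have := z v.
  by rewrite vr deg_nonroot // => /eqP; case: (nchild v) => [|[]].
apply/eqP; rewrite sum_nat_eq0; apply/forallP => v; apply/implyP => vr.
by have := d2 v vr; rewrite deg_nonroot //; case: (nchild v) => [|[]].
Qed.

(** The boolean, read as 0 or 1, treats stars and other trees at once. *)
Lemma excess_ge : (deg G r < #|V|.-1) * (deg G r - 2) <= par_excess.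
Proof.
case: ltnP => // /inner_nbrs_gt0 K0; rewrite mul1n.
by apply: leq_trans par_excess_ge; apply: leq_pmull.
Qed.

(** Once the branch excess vanishes, [par_excess] is k (Delta - 2) with k the number of inner
    neighbours, and k is 0 exactly for a star. *)
Lemma excess_eq : 1 < deg G r ->
  branch_excess = 0 /\ par_excess = (deg G r < #|V|.-1) * (deg G r - 2) <->
  (forall v, v != r -> deg G v <= 2) /\ (deg G r = 2 \/ #|inner_nbrs| <= 1).
Proof.
move=> dr; have dV := deg_root_le.
have K1 := inner_nbrs_gt0; have K0 := inner_nbrs_eq0.
split=> [[/branch_excess_eq0 d2 E]|[d2 E]]; split=> //.
- move: E; rewrite par_excess_spider //; case: ltnP => [/K1 k1|/(conj dV)/andP].
    rewrite mul1n => /eqP; rewrite -[X in _ == X]mul1n eqn_mul2r.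
    by case/orP=> /eqP E; [left; lia|right; rewrite E].
  by rewrite -eqn_leq => /eqP/K0 -> _; right.
- exact/branch_excess_eq0.
- rewrite par_excess_spider //; case: E => [->|E]; first by rewrite !muln0.
  congr (_ * _); case: ltnP => [/K1|Vd]; first by lia.
  by apply: K0; lia.
Qed.

(** Descend from [x] through children until a childless vertex, which is a leaf. *)
Lemma exists_leg x : x != r -> par x = r -> exists s, is_leg G r (x :: s).
Proof.
move=> xr px.
pose down a b := (b != r) && (par b == a).
have [m dm] : exists m, forall v, depth v <= m.
  by exists (\max_v depth v) => v; apply: leq_bigmax.
have [s [ds cs]] : exists s, path down x s /\ nchild (last x s) = 0.
  have [k] := ubnP (m - depth x); elim: k x xr {px} => // k IH x xr mk.
  have [cx|/nchild_gt0[y yr py]] := posnP (nchild x); first by exists [::].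
  have dy := rooting_depth yr; rewrite py in dy.
  have [|s [ds cs]] := IH y yr; first by have := dm y; lia.
  by exists (y :: s); rewrite /= /down yr py eqxx.
exists s.
have drs : path down r (x :: s) by rewrite /= /down xr px eqxx.
have lr : last x s != r.
  by case/lastP: s ds {cs drs} => [//|s y]; rewrite last_rcons rcons_path => /and3P[].
split=> //.
- apply: sub_path drs => a b /andP[br /eqP <-].
  by rewrite adj_sym rooting_par_adj.
(* Depth strictly increases along the descent, so no vertex repeats. *)
- apply: (@map_uniq _ _ depth); apply: (sorted_uniq ltn_trans ltnn).
  apply: (homo_path (f := depth) (e := down)) drs => a b /andP[br /eqP <-].
  by rewrite (rooting_depth br).
- by rewrite /is_leaf /= deg_nonroot // cs.
Qed.

End Rooting.

(** * Legs of spiders and the extremal trees *)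

Section Legs.
Local Open Scope nat_scope.
Variables (V : finType) (G : sgraph V).

Lemma deg_ge_uniq x (s : seq V) : uniq s -> all (G x) s -> size s <= deg G x.
Proof.
move=> us /allP Gs; rewrite -(card_uniqP us); apply: subset_leq_card.
by apply/subsetP => y /Gs; rewrite inE.
Qed.

(** [w] is the vertex just before [x]. Away from [c] a vertex has at most one neighbour besides its
    predecessor, so each step is forced, and a leaf stops both paths. *)
Lemma path_to_leaf_unique c w x (s t : seq V) :
  (forall v, v != c -> deg G v <= 2) -> G x w ->
  c \notin x :: s -> c \notin x :: t ->
  path G x s -> uniq [:: w, x & s] -> deg G (last x s) = 1 ->
  path G x t -> uniq [:: w, x & t] -> deg G (last x t) = 1 -> s = t.
Proof.
move=> d2; elim: s w x t => [|y s IH] w x [|z t] //= Gxw cs ct.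
- move=> _ _ dx /andP[Gxz _] /andP[+ _] _.
  rewrite !inE !negb_or => /and3P[_ wz _].
  by have := @deg_ge_uniq x [:: w; z]; rewrite /= inE wz Gxw Gxz dx => /(_ isT isT).
- move=> /andP[Gxz _] /andP[+ _] _ _ _ dx.
  rewrite !inE !negb_or => /and3P[_ wz _].
  by have := @deg_ge_uniq x [:: w; y]; rewrite /= inE wz Gxw Gxz dx => /(_ isT isT).
move=> /andP[Gxy ps] /andP[ws us] ls /andP[Gxz pt] /andP[wt ut] lt.
have yz : y = z.
  (* Otherwise [w], [y], [z] are three neighbours of [x], which differs from [c]. *)
  apply/eqP/negP => /negP nyz.
  have := @deg_ge_uniq x [:: w; y; z]; rewrite /= !inE Gxw Gxy Gxz nyz.
  move: ws wt; rewrite !inE !negb_or => /and3P[_ -> _] /and3P[_ -> _].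
  move=> /(_ isT isT); have := d2 x.
  by move: cs; rewrite inE negb_or eq_sym => /andP[-> _] /(_ isT); lia.
rewrite -yz in pt ut lt ct *; congr cons.
apply: (IH x y) => //; first by rewrite adj_sym.
- by move: cs; rewrite inE negb_or => /andP[].
- by move: ct; rewrite inE negb_or => /andP[].
Qed.

(** Long legs start at an inner neighbour of [c], hence at the same one, and their continuation is
    forced. *)
Lemma long_leg_unique c (p q : seq V) :
  (forall v, v != c -> deg G v <= 2) -> #|inner_nbrs G c| <= 1 ->
  is_leg G c p -> is_leg G c q -> 1 < size p -> 1 < size q -> p = q.
Proof.
move=> d2 /card_le1_eqP K1.
have inner x y s : is_leg G c [:: x, y & s] -> x \in inner_nbrs G c.
  case=> _ /= /and3P[Gcx Gxy _] /andP[+ _] _; rewrite !inE !negb_or Gcx.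
  move=> /and3P[_ cy _].
  by apply: (@deg_ge_uniq x [:: c; y]); rewrite /= ?inE ?cy // adj_sym Gcx Gxy.
case: p => [|x [|y p]] //; case: q => [|z [|t q]] // lp lq _ _.
have zx := K1 _ _ (inner _ _ _ lp) (inner _ _ _ lq); rewrite {z}zx in lq *.
case: lp lq => _ /andP[Gcx pp] up ep [_ /andP[_ pq] uq eq].
congr cons; apply: (@path_to_leaf_unique c c x) => //.
- by rewrite adj_sym.
- by case/andP: up.
- by case/andP: uq.
Qed.

(** Serves for a path, with center at an end-vertex. *)
Lemma inner_nbrs_leaf c : deg G c = 1 -> #|inner_nbrs G c| <= 1.
Proof.
by move<-; apply: subset_leq_card; apply/subsetP => v; rewrite !inE => /andP[].
Qed.

(** If Delta > 2, the center must be [r] and long legs start exactly at its inner neighbours. If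
    Delta = 2, the tree is a path and both sides hold. *)
Lemma spider_le1_long_legP r : is_tree G -> 2 < #|V| ->
  1 < deg G r -> (forall v, deg G v <= deg G r) ->
  spider_le1_long_leg G <->
  (forall v, v != r -> deg G v <= 2) /\ (deg G r = 2 \/ #|inner_nbrs G r| <= 1).
Proof.
move=> tG V3 dr dmax; have [par [depth rt]] := tree_rooting r tG.
split=> [[_ [c cen legs]]|[d2 E]].
  have [dr2|dr2] := eqVneq (deg G r) 2; first by split=> [v _|]; [rewrite -dr2|left].
  have rc : r = c by apply: cen; lia.
  rewrite -{c}rc in cen legs; split=> [v|].
    by apply: contraR; rewrite -ltnNge => /cen ->.
  right; apply/card_le1_eqP => x y xK yK.
  have leg z : z \in inner_nbrs G r -> exists2 s, is_leg G r (z :: s) & 1 < size (z :: s).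
    move=> zK; have /inner_nbrsP := zK => /(_ _ _ rt)[zr pz _].
    have [s ls] := exists_leg rt zr pz; exists s => //.
    case: s ls => //= -[_ _ _]; rewrite /is_leaf /= => dz.
    by move: zK; rewrite inE dz andbF.
  have [[s ls ss] [t lt st]] := (leg x xK, leg y yK).
  by case: (legs _ _ lt ls st ss).
split.
  split=> //; apply: leq_trans (_ : #|[set r]| <= 1); last by rewrite cards1.
  apply: subset_leq_card; apply/subsetP => v; rewrite !inE.
  by apply: contraLR => /d2; rewrite -leqNgt.
case: E => [dr2|K1]; last first.
  exists r; first by move=> v; apply: contraTeq => /d2; rewrite -leqNgt.
  by move=> p q; apply: long_leg_unique.
(* A path with an internal root: its legs must be counted from an end-vertex. *)
have [c dc] : exists c, deg G c = 1.
  (* If every non-root vertex had a child, they would have at least n - 1 in all, but they have n -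
     1 - Delta. *)
  have /existsP[v /andP[vr /eqP cv]] : [exists v, (v != r) && (nchild r par v == 0)].
    rewrite -[X in is_true X]negbK negb_exists; apply/negP => /forallP all1.
    have : \sum_(v | v != r) 1 <= \sum_(v | v != r) nchild r par v.
      by apply: leq_sum => v vr; have := all1 v; rewrite vr lt0n.
    rewrite (sum_nchild_nonroot rt) sum1_card (cardC1 r); lia.
  by exists v; rewrite (deg_nonroot rt) // cv.
exists c => [v|p q]; first by rewrite ltnNge -dr2 dmax.
by apply: long_leg_unique (inner_nbrs_leaf dc) => v _; rewrite -dr2.
Qed.

End Legs.

(** * The bound and its equality case *)

Theorem theorem1 (R : realType) (lam : R) (n Delta : nat)
    (V : finType) (T : sgraph V) :
  - (1 / 2) <= lam -> (3 <= n)%N -> in_trees n Delta T ->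
  let bound : R :=
    if (Delta < n - 1)%N then
      n%:R * (lam + 2) ^+ 2 - 3 * (lam + 2)
        + (lam + 1) * (Delta%:R ^+ 2 - 3 * Delta%:R - lam)
    else (n%:R - 1) * (n%:R - 1 + lam) * (1 + lam) in
  bound <= GRM lam T /\ (GRM lam T = bound <-> spider_le1_long_leg T).
Proof.
move=> lamge n3 [tT nV DT] bound.
have [r Dr] : exists r, Delta = deg T r.
  have V0 : (0 < #|V|)%N by case: tT.
  by have [r E] := bigop.eq_bigmax (deg T) V0; exists r; rewrite -DT -E.
have dmax v : (deg T v <= deg T r)%N by rewrite -Dr -DT; apply: bigop.leq_bigmax.
have [par [depth rt]] := tree_rooting r tT.
(* If Delta <= 1, only [r] could have children, so n - 1 <= Delta, against n >= 3. *)
have dr : (1 < deg T r)%N.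
  rewrite ltnNge; apply/negP => dr1.
  have := sum_nchild_nonroot rt; rewrite big1; first by lia.
  move=> v vr; have := leq_trans (dmax v) dr1.
  by rewrite (deg_nonroot rt) // ltnS leqn0 => /eqP.
have dV := deg_root_le rt.
have [exge exeq] := (excess_ge rt, excess_eq rt dr).
have spider : spider_le1_long_leg T <-> _ :=
  spider_le1_long_legP tT (ltac:(lia)) dr dmax.
set Q := branch_excess r par in exeq.
set S := par_excess T r par in exge exeq.
set e := ((_ < _) * _)%N in exge exeq.
(* Here [e] is the least possible [S], so both terms of the gap are nonnegative. *)
have gap : GRM lam T = bound + ((lam + 1) * Q%:R + (S - e)%:R).
  rewrite (GRM_excess rt lam dr) -/Q -/S natrB // /e /bound Dr -nV subn1.
  have -> : #|V|%:R = (#|V|.-1)%:R + 1 :> R by rewrite natr1 prednK //; lia.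
  rewrite natrB //; case: ltnP => [_|Vd].
    by rewrite mul1n natrB //; ring.
  have -> : (#|V|.-1 = deg T r)%N by lia.
  by rewrite mul0n; ring.
have lam1 : 0 < lam + 1 by lra.
have [Q0 S0] : 0 <= (lam + 1) * Q%:R /\ 0 <= (S - e)%:R :> R.
  by split; rewrite ?mulr_ge0 ?ler0n // ltW.
split; first by rewrite gap lerDl addr_ge0.
rewrite spider -exeq gap; split=> [/eqP|[-> ->]]; last first.
  by rewrite subnn mulr0 !addr0.
rewrite -subr_eq0 addrAC subrr add0r paddr_eq0 // mulf_eq0 (gt_eqF lam1) /=.
(* Truncated, [S - e = 0] only says S <= e; [exge] gives the converse. *)
rewrite !pnatr_eq0 => /andP[/eqP-> /eqP Se]; split=> //; lia.
Qed.
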